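(* Let $\alpha$ be irrational and let $c>0$ be a constant. For any integer $K \ge 0$ and any integer $N$ with $q_K \le N<q_{K+1}$, \[ \sum_{\substack{n=1 \\ \| n \alpha \| \ge c/N}}^N \frac{1}{\| n \alpha \|} = 2N \log N +O\left( (a_{K+1}^{1/2} + \log s_{K+1}) N \right) . \] If in addition $4 (c a_{K+1})^{1/2} q_K \le N$, then \[ \sum_{\substack{n=1 \\ \| n \alpha \| \ge c/N}}^N \frac{1}{\| n \alpha \|} \ge 2N \log N + q_{K+1} -O((\log s_{K+1})N) . \] The implied constants depend only on $c$.
   Context: $\| x \|$ denotes the distance from $x$ to the nearest integer. $\alpha = [a_0; a_1, a_2, \ldots]$ is the continued fraction expansion of $\alpha$, with convergents $p_k/q_k = [a_0;a_1,\ldots,a_k]$ (so $q_0=1$), and $s_K = \sum_{k=1}^K a_k$. In error terms, $\log x$ means $\log \max\{e,x\}$. *)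

(* Defs.v *)
(* MathComp-Analysis, over an arbitrary R : realType. *)
From mathcomp Require Import all_boot all_order all_algebra.
From mathcomp Require Import classical_sets reals sequences exp.

Set Implicit Arguments.
Unset Strict Implicit.
Unset Printing Implicit Defensive.

Import Order.TTheory GRing.Theory Num.Theory.
Local Open Scope ring_scope.
Local Open Scope classical_set_scope.

Section ContinuedFractions.
Variable R : realType.
Implicit Types (x alpha : R) (k K : nat).

Definition dist_int x : R := inf [set `|x - m%:~R| | m in [set: int]].

(* The k-th complete quotient [a_k; a_(k+1), ...]; meaningful for all k only
   when alpha is irrational. *)
Fixpoint complete_quotient alpha k : R :=
  if k is k'.+1 then
    let x := complete_quotient alpha k' in (x - (Num.floor x)%:~R)^-1
  else alpha.

Definition partial_quotient alpha k : int :=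
  Num.floor (complete_quotient alpha k).

(* cfrac a [:: b_1; ...; b_n] is the finite continued fraction
   [a; b_1, ..., b_n]. *)
Fixpoint cfrac (a : int) (bs : seq int) : rat :=
  if bs is b :: bs' then a%:~R + (cfrac b bs')^-1 else a%:~R.

Definition convergent alpha k : rat :=
  cfrac (partial_quotient alpha 0)
        [seq partial_quotient alpha i | i <- iota 1 k].

Definition convergent_den alpha k : int := denq (convergent alpha k).

Definition sum_partial_quotients alpha K : int :=
  \sum_(1 <= k < K.+1) partial_quotient alpha k.

(* The logarithm used in error terms only. *)
Definition log_err x : R := ln (Num.max (expR 1) x).

Definition recip_dist_sum alpha (c : R) (N : nat) : R :=
  \sum_(1 <= n < N.+1 | c / N%:R <= dist_int (n%:R * alpha))
    (dist_int (n%:R * alpha))^-1.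

End ContinuedFractions.

(* Main.v *)
(* With s = s_{K+1}, replace 1/||n alpha|| by 1/(||n alpha|| + tau), tau = s/N.
   In a block of q_k consecutive n, the points n alpha are within 2/q_k of
   the equally spaced points m/q_k, so the smoothed sum over the block is
   2 q_k ln(1 + 1/tau) + O(1/tau + q_k). Since [1, N] splits into at most s such
   blocks, the smoothed sum is 2N ln N + O(N log s).
   Undoing the smoothing costs O(N log s) on the n with
   ||n alpha|| >= 1/(2 q_K). Each other n <= N is either a multiple j q_K, and then
   ||n alpha|| = j ||q_K alpha||, or q_{K+1} - i q_K, which happens only
   if q_{K+1} <= 2N and contributes O(N log s). The multiples with
   ||n alpha|| >= c/N contribute O(a_{K+1}^(1/2) N). When
   4 (c a_{K+1})^(1/2) q_K <= N they contribute at least q_{K+1} - 2N, because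
   the admissible j then include 1 or all of some interval [m, 3m - 1], and
   1/m + ... + 1/(3m - 1) >= ln 3 > 1. *)
Require Import Defs.
From mathcomp Require Import all_boot all_order all_algebra.
From mathcomp Require Import classical_sets reals sequences exp.
From mathcomp Require Import zify ring lra.

Set Implicit Arguments.
Unset Strict Implicit.
Unset Printing Implicit Defensive.

Import Order.TTheory GRing.Theory Num.Theory.
Local Open Scope ring_scope.

(** * Distance to the nearest integer *)

Section DistInt.
Context {R : realType}.
Implicit Types (x y : R) (m : int).

Lemma dist_int_le x m : dist_int x <= `|x - m%:~R|.
Proof. by apply: ge_inf; [exists 0 => _ [k _ <-] | exists m]. Qed.

Lemma le_dist_int x y : (forall m, y <= `|x - m%:~R|) -> y <= dist_int x.
Proof.
move=> le_y; apply: lb_le_inf; first by exists `|x - 0%:~R|, 0.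
by move=> _ [m _ <-].
Qed.

Lemma dist_int_ge0 x : 0 <= dist_int x.
Proof. exact: le_dist_int. Qed.

Lemma dist_int_small x : `|x| <= 2^-1 -> dist_int x = `|x|.
Proof.
move=> x_small; apply/eqP; rewrite eq_le; apply/andP; split.
  by have := dist_int_le x 0; rewrite subr0.
apply: le_dist_int => m; have [->|m_neq0] := eqVneq m 0; first by rewrite subr0.
have m_ge1 : 1 <= `|m%:~R| :> R by rewrite -intr_norm ler1z -gtz0_ge1 normr_gt0.
have := ler_normB m%:~R (m%:~R - x); rewrite subKr => ?.
have := ler_normD x (m%:~R - x); rewrite addrC subrK [in X in _ <= X]distrC => ?.
lra.
Qed.

Lemma dist_intDz x m : dist_int (x + m%:~R) = dist_int x.
Proof.
apply/eqP; rewrite eq_le; apply/andP; split; apply: le_dist_int => k.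
  by apply: le_trans (dist_int_le _ (k + m)) _; rewrite intrD opprD addrACA subrr addr0.
apply: le_trans (dist_int_le _ (k - m)) _.
by rewrite intrB opprB addrA.
Qed.

Lemma dist_int_attained x :
  exists2 m, dist_int x = `|x - m%:~R| & `|x - m%:~R| <= 2^-1.
Proof.
have := floor_itv (x + 2^-1); set m := Num.floor _; rewrite intrD => m_itv.
have small : `|x - m%:~R| <= 2^-1 by rewrite ler_norml; lra.
by exists m => //; rewrite -dist_int_small // -mulrNz dist_intDz.
Qed.

Lemma dist_int_lipschitz x y : `|dist_int x - dist_int y| <= `|x - y|.
Proof.
have le_lip (u v : R) : dist_int u - dist_int v <= `|u - v|.
  have [m -> _] := dist_int_attained v; rewrite lerBlDr.
  apply: le_trans (dist_int_le u m) _; rewrite addrC.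
  by apply: le_trans (ler_normD _ _); rewrite addrC subrKA.
by rewrite ler_norml lerNl opprB le_lip distrC le_lip.
Qed.

(** For [2 m <= q] the fraction is at most 1/2. Otherwise [m / q] is reflected to [(q - m) / q],
    since the distance is even and has period 1. *)
Lemma dist_int_frac (m q : nat) :
  (m < q)%N -> dist_int (m%:R / q%:R : R) = (minn m (q - m))%:R / q%:R.
Proof.
move=> lt_mq; have q_gt0 : 0 < q%:R :> R by rewrite ltr0n; lia.
have half (k : nat) : (k.*2 <= q)%N -> dist_int (k%:R / q%:R : R) = k%:R / q%:R.
  move=> le_kq; rewrite -[RHS]ger0_norm ?dist_int_small //;
    rewrite ?divr_ge0 ?ler0n //.
  rewrite ger0_norm ?divr_ge0 ?ler0n // ler_pdivrMr // mulrC ler_pdivlMr //.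
  by rewrite -natrM ler_nat muln2.
have [le_m|lt_m] := leqP (m.*2) q.
  by rewrite half // (minn_idPl _) //; lia.
rewrite (minn_idPr _); last by lia.
rewrite -(half (q - m)%N); last by lia.
rewrite natrB ?(ltnW lt_mq) // mulrBl divff ?gt_eqF //.
have distN (u : R) : dist_int (- u) = dist_int u.
  have neg (v : R) : dist_int (- v) <= dist_int v.
    apply: le_dist_int => k; apply: le_trans (dist_int_le _ (- k)) _.
    by rewrite mulrNz -opprD normrN.
  by apply/eqP; rewrite eq_le neg -{1}[u]opprK neg.
by rewrite -[RHS]distN opprB -[in RHS](mulr1z (1 : R)) -mulrNz dist_intDz.
Qed.

End DistInt.

(** * Harmonic sums *)

Section HarmonicSums.
Context {R : realType}.
Implicit Types (x y z : R) (f : nat -> R).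

(** Both bounds are [ln (1 + u) <= u], taken at [u = 1 / x] and at [u = - 1 / (x + 1)]. *)
Lemma ln_succ_itv x :
  0 < x -> (x + 1)^-1 <= ln (x + 1) - ln x <= x^-1.
Proof.
move=> x_gt0; have x1_gt0 : 0 < x + 1 by lra.
rewrite -ln_div ?posrE //; apply/andP; split.
  rewrite -lerN2 -lnV ?posrE ?divr_gt0 // invf_div.
  have -> : x / (x + 1) = 1 + - (x + 1)^-1 by field; rewrite gt_eqF.
  by apply: le_ln1Dx; rewrite ltrN2 invf_lt1 //; lra.
have -> : (x + 1) / x = 1 + x^-1 by field; rewrite gt_eqF.
by apply: le_ln1Dx; apply: lt_trans (_ : 0 < _); rewrite ?invr_gt0 //; lra.
Qed.

Lemma sum_inv_le_ln y q :
  0 < y -> \sum_(m < q) (m.+1%:R + y)^-1 <= ln (q%:R + y) - ln y.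
Proof.
move=> y_gt0; elim: q => [|q IHq]; first by rewrite big_ord0 add0r subrr.
rewrite big_ord_recr /=.
have /ln_succ_itv/andP[] : 0 < q%:R + y by rewrite ltr_wpDl ?ler0n.
rewrite (_ : q%:R + y + 1 = q.+1%:R + y); last by rewrite -natr1 addrAC.
by move=> ? _; lra.
Qed.

Lemma ln_le_sum_inv y q :
  0 < y -> ln (q%:R + y) - ln y <= \sum_(m < q) (m%:R + y)^-1.
Proof.
move=> y_gt0; elim: q => [|q IHq]; first by rewrite big_ord0 add0r subrr.
rewrite big_ord_recr /=.
have /ln_succ_itv/andP[] : 0 < q%:R + y by rewrite ltr_wpDl ?ler0n.
rewrite (_ : q%:R + y + 1 = q.+1%:R + y); last by rewrite -natr1 addrAC.
by move=> _ ?; lra.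
Qed.

Lemma harmonic_le q : \sum_(m < q.+1) (m.+1%:R : R)^-1 <= 1 + ln q.+1%:R.
Proof.
rewrite big_ord_recl /= invr1 lerD2l.
have := sum_inv_le_ln q (@ltr01 R); rewrite ln1 subr0 natr1.
by apply: le_trans; apply: ler_sum => m _; rewrite natr1.
Qed.

(** The bound is uniform in [q]: the first part is at most [1 + ln q], the second at least
    [ln (q + 1 + z) - ln (1 + z)], and the growth in [q] cancels. *)
Lemma sum_inv_gap_le z q :
  0 <= z ->
  \sum_(m < q) ((m.+1%:R : R)^-1 - (m.+1%:R + z)^-1) <= 1 + ln (1 + z).
Proof.
move=> z_ge0; have z1_gt0 : 0 < 1 + z by lra.
case: q => [|q]; first by rewrite big_ord0 addr_ge0 ?ln_ge0 ?lerDl //; lra.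
rewrite big_split /= sumrN.
have := harmonic_le q; have := ln_le_sum_inv q.+1 z1_gt0.
rewrite [X in _ <= X -> _](eq_bigr (fun m : 'I_q.+1 => (m.+1%:R + z)^-1));
  last by move=> m _; rewrite addrA natr1.
suff : ln q.+1%:R <= ln (q.+1%:R + (1 + z)) by lra.
have q_gt0 : 0 < q.+1%:R :> R by rewrite ltr0n.
by rewrite ler_ln ?posrE; lra.
Qed.

Lemma sum_inv_sqrt_le q :
  \sum_(m < q) (Num.sqrt (m.+1%:R : R))^-1 <= 2 * Num.sqrt q%:R.
Proof.
elim: q => [|q IHq]; first by rewrite big_ord0 sqrtr0 mulr0.
rewrite big_ord_recr /=; apply: le_trans (lerD IHq (lexx _)) _.
have s_gt0 : 0 < Num.sqrt (q.+1%:R : R) by rewrite sqrtr_gt0 ltr0n.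
rewrite -(ler_pM2r s_gt0) mulrDl mulVf ?gt_eqF //.
have eqS : Num.sqrt (q.+1%:R : R) ^+ 2 = q%:R + 1 by rewrite sqr_sqrtr ?natr1.
have eqq : Num.sqrt (q%:R : R) ^+ 2 = q%:R by rewrite sqr_sqrtr.
(* Multiplied by [sqrt (q + 1)], the induction step is the nonnegativity of this square. *)
have := sqr_ge0 (Num.sqrt (q.+1%:R : R) - Num.sqrt q%:R).
by rewrite sqrrB eqS eqq => ?; nra.
Qed.

(** [ln (7/8) <= - 1/8] and [1/3 <= (7/8)^8] together give [- ln 3 <= - 1]. *)
Lemma ln3_ge1 : 1 <= ln 3 :> R.
Proof.
have : ln (1 + - 8%:R^-1) <= - 8%:R^-1 :> R by apply: le_ln1Dx; lra.
have pos : 0 < 1 + - 8%:R^-1 :> R by lra.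
have : ln (3^-1) <= ln ((1 + - 8%:R^-1) ^+ 8) :> R.
  by rewrite ler_ln ?posrE ?exprn_gt0 //; lra.
by rewrite lnXn // lnV ?posrE // -mulr_natl; lra.
Qed.

Lemma sum_inv_triple_ge1 k : 1 <= \sum_(m < k.+1.*2) ((m + k.+1)%:R : R)^-1.
Proof.
have k_gt0 : 0 < k.+1%:R :> R by rewrite ltr0n.
under eq_bigr do rewrite natrD.
apply: le_trans (ln_le_sum_inv _ k_gt0).
rewrite -natrD (_ : (_ + _)%N = (3 * k.+1)%N); last by lia.
by rewrite natrM lnM ?posrE // addrK ln3_ge1.
Qed.

(** This bound and the next price a shift of the index by one at [f 0]; they absorb the displacement
    of the block points from the grid. *)
Lemma sum_pred_le f q : (forall m, 0 <= f m <= f 0) ->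
  \sum_(m < q) f m.-1 <= f 0 + \sum_(m < q) f m.
Proof.
move=> f_bnd; have f_ge0 m : 0 <= f m by case/andP: (f_bnd m).
case: q => [|q]; first by rewrite !big_ord0 addr0.
by rewrite big_ord_recl lerD2l big_ord_recr /= lerDl.
Qed.

Lemma sum_le_succ f q : (forall m, 0 <= f m) ->
  \sum_(m < q) f m <= f 0 + \sum_(m < q) f m.+1.
Proof.
move=> f_ge0; case: q => [|q]; first by rewrite !big_ord0 addr0.
by rewrite big_ord_recl lerD2l [leRHS]big_ord_recr /= lerDl.
Qed.

(** The minimum and the maximum are [m] and [q - m] in some order, and reversing the range turns
    [q - m] into [m + 1]. This reduces sums over the numerators of the distances of [m / q] to
    ordinary sums. *)
Lemma sum_minn_maxn f q :
  \sum_(m < q) f (minn m (q - m)) + \sum_(m < q) f (maxn m (q - m)) =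
  \sum_(m < q) f m + \sum_(m < q) f m.+1.
Proof.
have -> : \sum_(m < q) f m.+1 = \sum_(m < q) f (q - m)%N.
  rewrite (reindex_inj rev_ord_inj) /=; apply: eq_bigr => m _.
  by rewrite subnSK.
rewrite -!big_split /=; apply: eq_bigr => m _.
by case: (leqP m (q - m)) => _ //; rewrite addrC.
Qed.

Lemma sum_minn_le f q : (forall m, 0 <= f m) ->
  \sum_(m < q) f (minn m (q - m)) <= \sum_(m < q) f m + \sum_(m < q) f m.+1.
Proof. by move=> f_ge0; rewrite -sum_minn_maxn lerDl sumr_ge0. Qed.

Lemma sum_gap_minn_le z q : 0 <= z ->
  \sum_(m < q) (((minn m (q - m)).+1%:R : R)^-1 - ((minn m (q - m)).+1%:R + z)^-1)
    <= 2 * (1 + ln (1 + z)).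
Proof.
move=> z_ge0; pose g m : R := m.+1%:R^-1 - (m.+1%:R + z)^-1.
have g_ge0 m : 0 <= g m.
  by rewrite subr_ge0 lef_pV2 ?posrE ?ltr_wpDr ?ltr0n // lerDl.
have := sum_minn_le q g_ge0; have := sum_inv_gap_le q z_ge0.
(* The sum of the [g m.+1] is the sum of [q + 1] values of [g] without [g 0], which is
   nonnegative. *)
have := sum_inv_gap_le q.+1 z_ge0; rewrite big_ord_recl -/(g 0%N) => ? ? ?.
by have := g_ge0 0%N; rewrite -/(g _); lra.
Qed.

Lemma sum_dvdn f q M : (0 < q)%N ->
  \sum_(n < M | (q %| n.+1)%N) f (n.+1 %/ q)%N = \sum_(j < M %/ q) f j.+1.
Proof.
move=> q_gt0; elim: M => [|M IHM]; first by rewrite div0n !big_ord0.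
rewrite big_mkcond big_ord_recr -big_mkcond /= IHM divnS //.
by case: (q %| M.+1)%N => /=; rewrite ?addr0 // add1n big_ord_recr.
Qed.

End HarmonicSums.

(** * Blocks of q consecutive multiples of alpha *)

Section Block.
Context {R : realType}.
Variables (alpha : R) (p : int) (q : nat).
Hypotheses (q_gt0 : (0 < q)%N) (coprime_pq : coprimez p q).
Hypothesis approx : `|q%:R * alpha - p%:~R| <= q%:R^-1.

Let qR_gt0 : 0 < q%:R :> R. Proof. by rewrite ltr0n. Qed.

(* With [w] the integer part of [q n0 alpha], [w + i p] runs over all residues
   mod [q] and differs from [q (n0 + i) alpha] by at most 2. *)
Lemma block_residues n0 :
  exists2 h : 'I_q -> 'I_q, injective h &
    forall i : 'I_q,
      `|dist_int ((n0 + i)%:R * alpha) - (minn (h i) (q - h i))%:R / q%:R|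
        <= 2 / q%:R.
Proof.
pose w := Num.floor (q%:R * (n0%:R * alpha)).
pose r (i : nat) := (w + i%:Z * p)%R.
have q_neq0 : q%:Z != 0 by rewrite eqz_nat -lt0n.
have r_lt i : (`|(r i %% q)%Z| < q)%N.
  by rewrite -ltz_nat gez0_abs ?modz_ge0 // ltz_pmod.
exists (fun i => Ordinal (r_lt i)) => [i j /(congr1 val) /= eq_ij | i /=].
  have /eqP : (r i %% q)%Z = (r j %% q)%Z.
    by rewrite -[LHS]gez0_abs ?modz_ge0 // eq_ij gez0_abs ?modz_ge0.
  rewrite eqz_mod_dvd (_ : r i - r j = (i%:Z - j%:Z) * p); last by rewrite /r; ring.
  rewrite Gauss_dvdzl 1?coprimez_sym // -eqz_mod_dvd !modz_nat !modn_small //.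
  by rewrite eqz_nat => /eqP/val_inj.
rewrite -dist_int_frac // -(dist_intDz (_ / _) (r i %/ q)%Z).
apply: le_trans (dist_int_lipschitz _ _) _.
have r_eq : (r i)%:~R = (r i %/ q)%Z%:~R * q%:R + `|(r i %% q)%Z|%:R :> R.
  by rewrite [in LHS](divz_eq (r i) q) intrD intrM natr_absz ger0_norm ?modz_ge0.
rewrite -(ler_pM2r qR_gt0) -[X in _ * X <= _]gtr0_norm // -normrM.
rewrite divfK ?gt_eqF //.
rewrite (_ : _ * q%:R = q%:R * (n0%:R * alpha) - w%:~R
                        + i%:R * (q%:R * alpha - p%:~R)); last first.
  rewrite mulrBl mulrDl divfK ?gt_eqF // [_ + _ * q%:R]addrC -r_eq natrD.
  by rewrite /r intrD intrM; ring.
have i_le : `|i%:R * (q%:R * alpha - p%:~R)| <= 1.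
  rewrite normrM ger0_norm ?ler0n // -[leRHS](mulfV (lt0r_neq0 qR_gt0)).
  by apply: ler_pM; rewrite ?ler0n ?normr_ge0 ?ler_nat ?(ltnW (ltn_ord i)).
have := floor_itv (q%:R * (n0%:R * alpha)); rewrite -/w intrD.
by move: i_le; rewrite !ler_norml; lra.
Qed.

(** An injective [h] permutes the residues, so the block is compared with the grid point by point
    after reindexing. *)
Lemma block_sum_le (F G : nat -> R) n0 :
  (forall n m, (m <= q)%N ->
     `|dist_int (n%:R * alpha) - m%:R / q%:R| <= 2 / q%:R -> F n <= G m) ->
  \sum_(i < q) F (n0 + i)%N <= \sum_(m < q) G (minn m (q - m)).
Proof.
move=> le_FG; have [h h_inj h_close] := block_residues n0.
rewrite [leRHS](reindex_inj h_inj); apply: ler_sum => i _.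
by apply: le_FG (h_close i); rewrite geq_min ltnW.
Qed.

(** Here [f m] is the smoothed term at the grid point [m / q]. A displacement by [2 / q] moves the
    index by two, and each unit shift costs at most [f 0 = 1 / tau]; five such costs arise on either
    side. *)
Lemma block_sum_inv n0 (tau : R) : 0 < tau ->
  `|\sum_(i < q) (dist_int ((n0 + i)%:R * alpha) + tau)^-1
    - q%:R * (2 * ln (1 + tau^-1))| <= 6 / tau + 2 * q%:R.
Proof.
move=> tau_gt0; set y := q%:R * tau; have y_gt0 : 0 < y by rewrite mulr_gt0.
pose f m : R := q%:R * (m%:R + y)^-1.
have my_gt0 (m : nat) : 0 < m%:R + y by rewrite ltr_wpDl ?ler0n.
have f_ge0 m : 0 <= f m by rewrite mulr_ge0 ?ler0n // invr_ge0 ltW.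
have f_anti m n : (m <= n)%N -> f n <= f m.
  by move=> le_mn; rewrite ler_pM2l // lef_pV2 ?posrE // lerD2r ler_nat.
have f_bnd m : 0 <= f m <= f 0%N by rewrite f_ge0 f_anti.
have f0E : f 0%N = tau^-1 by rewrite /f add0r invfM mulrA mulfV ?mul1r ?gt_eqF.
have lnE : ln (q%:R + y) - ln y = ln (1 + tau^-1).
  rewrite -ln_div ?posrE ?addr_gt0 //; congr ln; rewrite /y.
  by field; rewrite !gt_eqF.
have scale (x : R) : 0 <= x -> (x + tau)^-1 = q%:R * (q%:R * x + y)^-1.
  move=> x_ge0; rewrite /y -mulrDr invfM mulrA mulfV ?mul1r // gt_eqF //.
have close n m : `|dist_int (n%:R * alpha) - m%:R / q%:R| <= 2 / q%:R ->
    m%:R - 2 <= q%:R * dist_int (n%:R * alpha) <= m%:R + 2.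
  rewrite ler_norml => /andP[lo hi].
  have -> : m%:R = q%:R * (m%:R / q%:R) :> R by field; rewrite gt_eqF.
  have -> : 2 = q%:R * (2 / q%:R) :> R by field; rewrite gt_eqF.
  by rewrite -mulrBr -mulrDr !ler_pM2l //; lra.
have sum_f_ge : q%:R * ln (1 + tau^-1) <= \sum_(m < q) f m.
  by rewrite -mulr_sumr ler_pM2l // -lnE ln_le_sum_inv.
have sum_f_le : \sum_(m < q) f m.+1 <= q%:R * ln (1 + tau^-1).
  by rewrite -mulr_sumr ler_pM2l // -lnE sum_inv_le_ln.
have shift0 := sum_le_succ q f_ge0.
rewrite ler_norml; apply/andP; split.
- have : \sum_(i < q) - (dist_int ((n0 + i)%:R * alpha) + tau)^-1
         <= \sum_(m < q) - f (minn m (q - m)).+2.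
    apply: (@block_sum_le (fun n => - (dist_int (n%:R * alpha) + tau)^-1)
                          (fun m => - f m.+2)) => n m _ /close/andP[_ le_x].
    rewrite lerN2 scale ?dist_int_ge0 // ler_pM2l // lef_pV2 ?posrE //; last 1 first.
      by rewrite ltr_wpDl // mulr_ge0 ?ler0n ?dist_int_ge0.
    by rewrite -addn2 natrD lerD2r.
  have := sum_minn_maxn (fun m => f m.+2) q.
  (* The larger of [m] and [q - m] is at least [q / 2], so each term removed by passing to the
     minimum is at most 2. *)
  have : \sum_(m < q) f (maxn m (q - m)).+2 <= \sum_(m < q) 2.
    apply: ler_sum => m _; rewrite /f ler_pdivrMr //.
    apply: le_trans (_ : 2 * (maxn m (q - m)).+2%:R <= _).
      by rewrite -natrM ler_nat; lia.
    by rewrite ler_pM2l // lerDl ltW.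
  rewrite sumr_const card_ord -mulr_natr !sumrN.
  have := sum_le_succ q (fun m => f_ge0 m.+1).
  have := sum_le_succ q (fun m => f_ge0 m.+2).
  have : 0 <= f 0%N - f 1%N by rewrite subr_ge0 f_anti.
  have : 0 <= f 0%N - f 2%N by rewrite subr_ge0 f_anti.
  by rewrite f0E in shift0 *; lra.
- have : \sum_(i < q) (dist_int ((n0 + i)%:R * alpha) + tau)^-1
         <= \sum_(m < q) f (minn m (q - m)).-2.
    apply: (@block_sum_le (fun n => (dist_int (n%:R * alpha) + tau)^-1)
                          (fun m => f m.-2)) => n m _ /close/andP[ge_x _].
    rewrite scale ?dist_int_ge0 // ler_pM2l // lef_pV2 ?posrE //; last first.
      by rewrite ltr_wpDl // mulr_ge0 ?ler0n ?dist_int_ge0.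
    (* For [m <= 1] the index [m.-2] is 0, and nonnegativity of the distance suffices. *)
    rewrite lerD2r; case: m ge_x => [|[|m]] /= ge_x.
    - by rewrite mulr_ge0 ?ler0n ?dist_int_ge0.
    - by rewrite mulr_ge0 ?ler0n ?dist_int_ge0.
    - by apply: le_trans ge_x; rewrite -addn2 natrD addrK.
  have := sum_minn_le q (fun m => f_ge0 m.-2).
  have := sum_pred_le q f_bnd.
  have /(sum_pred_le q) /= : forall m, 0 <= f m.-1 <= f 0.-1 by [].
  have : 0 <= q%:R :> R by rewrite ler0n.
  have : 0 <= tau^-1 by rewrite invr_ge0 ltW.
  by rewrite f0E in shift0 *; lra.
Qed.

Lemma block_sums_inv b n0 (tau : R) : 0 < tau ->
  `|\sum_(i < b * q) (dist_int ((n0 + i)%:R * alpha) + tau)^-1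
    - (b * q)%:R * (2 * ln (1 + tau^-1))| <= b%:R * (6 / tau + 2 * q%:R).
Proof.
move=> tau_gt0; elim: b => [|b IHb].
  by rewrite mul0n big_ord0 !mul0r subrr normr0.
move: (block_sum_inv (n0 + b * q) tau_gt0) IHb.
move: (2 * ln _) (6 / tau + _) => I E le_E IHb.
rewrite mulSnr big_split_ord /= natrD -[b.+1%:R]natr1 [_ * I]mulrDl.
rewrite [_ * E]mulrDl mul1r opprD addrACA.
apply: le_trans (ler_normD _ _) (lerD IHb _).
by under eq_bigr do rewrite addnA.
Qed.

(** Nonnegative terms allow the range to be extended to [N %/ q + 1] full blocks, at most [2 N / q]
    of them because [q <= N]. *)
Lemma sum_le_block_sum (F G : nat -> R) N : (q <= N)%N -> (forall n, 0 <= F n) ->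
  (forall n m, (m <= q)%N ->
     `|dist_int (n%:R * alpha) - m%:R / q%:R| <= 2 / q%:R -> F n <= G m) ->
  \sum_(i < N) F i.+1 <= 2 * N%:R / q%:R * \sum_(m < q) G (minn m (q - m)).
Proof.
move=> le_qN F_ge0 le_FG; set S := \sum_(m < q) _.
have S_ge0 : 0 <= S.
  by apply: le_trans (block_sum_le 0 le_FG); apply: sumr_ge0.
have blocks b : \sum_(i < b * q) F i.+1 <= b%:R * S.
  elim: b => [|b IHb]; first by rewrite mul0n big_ord0 mul0r.
  rewrite mulSnr big_split_ord /= -natr1 mulrDl mul1r lerD //.
  under eq_bigr do rewrite -addSn.
  exact: block_sum_le.
pose b := (N %/ q).+1; have lt_Nb : (N < b * q)%N by rewrite /b ltn_ceil.
apply: le_trans (_ : b%:R * S <= _).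
  apply: le_trans (blocks b); rewrite -(subnKC (ltnW lt_Nb)) big_split_ord /=.
  by rewrite lerDl sumr_ge0.
apply: ler_wpM2r => //; rewrite ler_pdivlMr // -!natrM ler_nat /b mulSn mul2n -addnn.
by rewrite leq_add // leq_trunc_div.
Qed.

(** One majorant serves two purposes: [d = 8 q], [z = 8 q tau] bounds the cost of smoothing far from
    the integers, and [z = 1] counts the points close to them. *)
Lemma sum_le_gap (F : nat -> R) (d z : R) N :
  (q <= N)%N -> 0 <= d -> 0 <= z -> (forall n, 0 <= F n) ->
  (forall n m, (m <= q)%N ->
     `|dist_int (n%:R * alpha) - m%:R / q%:R| <= 2 / q%:R ->
     F n <= d * (m.+1%:R^-1 - (m.+1%:R + z)^-1)) ->
  \sum_(i < N) F i.+1 <= 4 * N%:R / q%:R * d * (1 + ln (1 + z)).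
Proof.
move=> le_qN d_ge0 z_ge0 F_ge0 le_Fd.
apply: le_trans (sum_le_block_sum le_qN F_ge0 le_Fd) _.
rewrite -mulr_sumr mulrA.
have -> : 4 * N%:R / q%:R * d * (1 + ln (1 + z)) =
  2 * N%:R / q%:R * d * (2 * (1 + ln (1 + z))) by ring.
apply: ler_wpM2l; last exact: sum_gap_minn_le.
by rewrite mulr_ge0 // divr_ge0 ?mulr_ge0 ?ler0n.
Qed.

Lemma far_sum_le N (tau : R) : (q <= N)%N -> 0 <= tau ->
  \sum_(i < N | (2 * q%:R)^-1 <= dist_int (i.+1%:R * alpha))
    ((dist_int (i.+1%:R * alpha))^-1 - (dist_int (i.+1%:R * alpha) + tau)^-1)
  <= 32 * N%:R * (1 + ln (1 + 8 * q%:R * tau)).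
Proof.
move=> le_qN tau_ge0; rewrite big_mkcond /=.
pose gap (x : R) := x^-1 - (x + tau)^-1.
pose F n : R := if (2 * q%:R)^-1 <= dist_int (n%:R * alpha)
                then gap (dist_int (n%:R * alpha)) else 0.
have q2_gt0 : 0 < (2 * q%:R)^-1 :> R by rewrite invr_gt0 mulr_gt0.
have z_ge0 : 0 <= 8 * q%:R * tau by rewrite !mulr_ge0 ?ler0n.
have -> : 32 * N%:R * (1 + ln (1 + 8 * q%:R * tau)) =
  4 * N%:R / q%:R * (8 * q%:R) * (1 + ln (1 + 8 * q%:R * tau)).
  by field; rewrite gt_eqF.
apply: (@sum_le_gap F) => // [|n|n m _ close_m]; first by rewrite mulr_ge0 ?ler0n.
  rewrite /F; case: ifP => // far; rewrite subr_ge0 lef_pV2 ?posrE ?lerDl //; lra.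
set d := _ * (_ - _).
have d_ge0 : 0 <= d.
  by rewrite mulr_ge0 ?mulr_ge0 ?ler0n // subr_ge0 lef_pV2 ?posrE ?ltr_wpDr ?ltr0n ?lerDl.
rewrite /F; case: ifP => // far.
pose x := m.+1%:R / (8 * q%:R) : R.
have x_gt0 : 0 < x by rewrite divr_gt0 ?mulr_gt0 ?ltr0n.
have -> : d = gap x.
  have -> : gap x = x^-1 - ((m.+1%:R + 8 * q%:R * tau) / (8 * q%:R))^-1.
    by rewrite /gap mulrDl [8 * _ * tau]mulrC mulfK // gt_eqF ?mulr_gt0.
  by rewrite !invf_div -mulrBr.
(* With [X = q * dist_int (n * alpha)], the bounds [X >= 1/2] and [X >= m - 2] give [8 X >= m + 1];
   the gap decreases in its argument. *)
have x_le : x <= dist_int (n%:R * alpha).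
  rewrite /x ler_pdivrMr ?mulr_gt0 //.
  have : 1 <= 2 * q%:R * dist_int (n%:R * alpha).
    by rewrite mulrC -ler_pdivrMr ?mulr_gt0 // div1r.
  have : m%:R - 2 <= q%:R * dist_int (n%:R * alpha).
    have -> : m%:R - 2 = q%:R * (m%:R / q%:R - 2 / q%:R) :> R.
      by field; rewrite gt_eqF.
    by rewrite ler_pM2l //; move: close_m; rewrite ler_norml; lra.
  rewrite -natr1; lra.
have gapE (u : R) : 0 < u -> gap u = tau * (u * (u + tau))^-1.
  by move=> u_gt0; rewrite /gap; field; rewrite !gt_eqF //; lra.
have y_gt0 := lt_le_trans x_gt0 x_le.
rewrite !gapE //; apply: ler_wpM2l => //.
rewrite lef_pV2 ?posrE ?mulr_gt0 //; try lra.
by apply: ler_pM => //; lra.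
Qed.

(** At [z = 1] the majorant is [1 / ((m + 1) (m + 2))], which exceeds [1 / (B + 4)^2] because a
    counted point has [m < B + 2]. The factor 8 comes from [4 (1 + ln 2)]. *)
Lemma near_count_le N (B : R) : (q <= N)%N -> 0 <= B ->
  \sum_(i < N | dist_int (i.+1%:R * alpha) < B / q%:R) 1
  <= 8 * (B + 4) ^+ 2 * (N%:R / q%:R).
Proof.
move=> le_qN B_ge0; rewrite big_mkcond /=.
pose F n : R := if dist_int (n%:R * alpha) < B / q%:R then 1 else 0.
have sq_ge0 : 0 <= (B + 4) ^+ 2 by rewrite sqr_ge0.
have Nq_ge0 : 0 <= N%:R / q%:R :> R by rewrite divr_ge0 ?ler0n.
apply: le_trans (_ : 4 * N%:R / q%:R * (B + 4) ^+ 2 * (1 + ln (1 + 1)) <= _);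
  last first.
  have : ln (1 + 1) <= 1 :> R by apply: le_ln1Dx; lra.
  rewrite -[4 * _ / _]mulrA; move: (N%:R / _) Nq_ge0 ((B + 4) ^+ 2) sq_ge0.
  by move=> u u_ge0 v v_ge0; have := mulr_ge0 u_ge0 v_ge0; nra.
apply: (@sum_le_gap F) => // [n|n m _ close_m]; first by rewrite /F; case: ifP.
have m_ge0 := ler0n R m.
have gapE : m.+1%:R^-1 - (m.+1%:R + 1)^-1 = ((m%:R + 1) * (m%:R + 2))^-1 :> R.
  have m1_neq0 : m%:R + 1 != 0 :> R by rewrite gt_eqF //; lra.
  have m2_neq0 : m%:R + 2 != 0 :> R by rewrite gt_eqF //; lra.
  by rewrite -natr1 -addrA -[1 + 1]/2; field; rewrite m1_neq0 m2_neq0.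
rewrite gapE /F; case: ifP => near; last first.
  by rewrite mulr_ge0 // invr_ge0 mulr_ge0 //; lra.
rewrite ler_pdivlMr ?mulr_gt0 //; try lra.
have : m%:R < B + 2.
  have -> : B + 2 = q%:R * (B / q%:R + 2 / q%:R) by field; rewrite gt_eqF.
  have -> : m%:R = q%:R * (m%:R / q%:R) :> R by field; rewrite gt_eqF.
  by rewrite ltr_pM2l //; move: close_m; rewrite ler_norml; lra.
by rewrite expr2; nra.
Qed.

End Block.

(** * Continued fractions *)

Section Continuants.

(* The solution of [u_k = a_k u_(k-1) + u_(k-2)] with [u_(-1) = u] and
   [u_0 = v]; the value [a 0] is not used. *)
Fixpoint continuant (a : nat -> int) (u v : int) (k : nat) : int :=
  if k is k'.+1 then
    a k * continuant a u v k' +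
    (if k' is k''.+1 then continuant a u v k'' else u)
  else v.

Definition cf_num (a : nat -> int) := continuant a 1 (a 0%N).
Definition cf_den (a : nat -> int) := continuant a 0 1.

Lemma continuantSS a u v k :
  continuant a u v k.+2 = a k.+2 * continuant a u v k.+1 + continuant a u v k.
Proof. by []. Qed.

Lemma nat_ind2 (P : nat -> Prop) :
  P 0%N -> P 1%N -> (forall k, P k -> P k.+1 -> P k.+2) -> forall k, P k.
Proof.
move=> P0 P1 PSS k; suff [] : P k /\ P k.+1 by [].
by elim: k => [|k [Pk PSk]]; split => //; apply: PSS.
Qed.

Lemma continuant_ge1 a u v k : (forall i, 1 <= a i.+1) -> 0 <= u -> 1 <= v ->
  1 <= continuant a u v k.
Proof.
move=> a_ge1 u_ge0 v_ge1; elim/nat_ind2: k => [//||k IHk IHk1].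
  by have := a_ge1 0%N; rewrite /=; nia.
by have := a_ge1 k.+1; rewrite continuantSS; nia.
Qed.

(** [continuant] adds partial quotients at the back while [cfrac] unfolds from the front; this and
    [cf_denS] peel off [a 0] and reconcile the two. *)
Lemma cf_numS a k : cf_num a k.+1 =
  a 0%N * cf_num (a \o S) k + cf_den (a \o S) k.
Proof.
rewrite /cf_num /cf_den; elim/nat_ind2: k => [||k IHk IHk1]; [by rewrite /=; ring..|].
by rewrite [LHS]continuantSS IHk IHk1 !continuantSS /=; ring.
Qed.

Lemma cf_denS a k : cf_den a k.+1 = cf_num (a \o S) k.
Proof.
rewrite /cf_num /cf_den; elim/nat_ind2: k => [||k IHk IHk1]; [by rewrite /=; ring..|].
by rewrite [LHS]continuantSS IHk IHk1.
Qed.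

Lemma cf_det a k :
  cf_den a k.+1 * cf_num a k - cf_den a k * cf_num a k.+1 = - (-1) ^+ k.
Proof.
elim: k => [|k IHk]; first by rewrite /cf_den /cf_num /=; ring.
by rewrite exprS mulN1r -IHk /cf_den /cf_num 2!continuantSS; ring.
Qed.

Lemma cf_coprime a k : coprimez (cf_num a k) (cf_den a k).
Proof.
apply/coprimezP; exists (- (-1) ^+ k * cf_den a k.+1, (-1) ^+ k * cf_num a k.+1) => /=.
transitivity (- ((-1) ^+ k *
  (cf_den a k.+1 * cf_num a k - cf_den a k * cf_num a k.+1))); first by ring.
by rewrite cf_det mulrN opprK -exprMn mulrNN mulr1 expr1n.
Qed.

Lemma cfrac_continuant (a : nat -> int) k : (forall i, 1 <= a i.+1) ->
  cfrac (a 0%N) [seq a i | i <- iota 1 k] =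
  (cf_num a k)%:~R / (cf_den a k)%:~R.
Proof.
elim: k a => [|k IHk] a a_ge1; first by rewrite /= divr1.
rewrite /= -[2%N]/(1 + 1)%N iotaDl -map_comp [X in _ + X^-1](IHk (a \o S)); last first.
  by move=> i; apply: a_ge1.
have num_neq0 : (cf_num (a \o S) k)%:~R != 0 :> rat.
  by rewrite intr_eq0 gt_eqF // gtz0_ge1 continuant_ge1 //= a_ge1.
by rewrite invf_div cf_numS cf_denS intrD intrM mulrDl mulfK.
Qed.

End Continuants.

(** * Convergents of an irrational number *)

Section Convergents.
Context {R : realType}.
Variable alpha : R.
Hypothesis alpha_irr : irrational alpha.

Local Notation A := (complete_quotient alpha).
Local Notation a := (partial_quotient alpha).
Local Notation p := (cf_num a).
Local Notation q := (cf_den a).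
Local Notation delta k := ((q k)%:~R * alpha - (p k)%:~R).

(** Keeps every fractional part nonzero, so that the inverse in [complete_quotient] never takes its
    default value 0. *)
Lemma complete_quotient_irrational k : irrational (A k).
Proof.
elim: k => [//|k IHk] [r _ rE]; apply: IHk.
exists ((Num.floor (A k))%:~R + r^-1) => //.
by rewrite rmorphD fmorphV /= rE ratr_int invrK addrC subrK.
Qed.

Lemma complete_quotient_frac k : 0 < A k - (a k)%:~R < 1.
Proof.
have := floor_itv (A k); rewrite -/(a k) intrD => /andP[].
rewrite le_eqVlt => /orP[/eqP A_eq|]; last by lra.
case: (@complete_quotient_irrational k); exists (a k)%:~R => //.
by rewrite ratr_int.
Qed.

Lemma complete_quotient_gt1 k : 1 < A k.+1.
Proof. by have /andP[? ?] := complete_quotient_frac k; rewrite /= invf_gt1. Qed.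

Lemma partial_quotient_ge1 k : 1 <= a k.+1.
Proof. by rewrite floor_ge_int ltW // complete_quotient_gt1. Qed.

Lemma cf_den_ge1 k : 1 <= q k.
Proof. exact: continuant_ge1 partial_quotient_ge1 _ _. Qed.

Lemma cf_den_mono k : q k <= q k.+1.
Proof.
have := partial_quotient_ge1 k; case: k => [|k]; first by rewrite /cf_den /=; lia.
have := cf_den_ge1 k; have := cf_den_ge1 k.+1.
have -> : q k.+2 = a k.+2 * q k.+1 + q k by [].
by nia.
Qed.

Lemma cf_denS_le k : q k.+1 <= (a k.+1 + 1) * q k.
Proof.
case: k => [|k]; first by rewrite /cf_den /=; lia.
have -> : q k.+2 = a k.+2 * q k.+1 + q k by [].
by have := cf_den_mono k; nia.
Qed.

(** Coprimality makes [p k / q k] a reduced fraction, and [q k] is positive. *)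
Lemma convergent_denE k : convergent_den alpha k = q k.
Proof.
rewrite /convergent_den /convergent cfrac_continuant; last exact: partial_quotient_ge1.
rewrite coprimeq_den; last exact: cf_coprime.
have := cf_den_ge1 k; case: eqP => [->//|_]; lia.
Qed.

(** Equivalent to [alpha = (A p_(k+1) + p_k) / (A q_(k+1) + q_k)] with [A = A k.+2]. Since [A > 1],
    it shows that the errors alternate in sign and decrease in size. *)
Lemma complete_quotient_delta k : A k.+2 * delta k.+1 = - delta k.
Proof.
have AS i : A i.+1 * (A i - (a i)%:~R) = 1.
  rewrite /= mulVf // gt_eqF //; by case/andP: (complete_quotient_frac i).
elim: k => [|k IHk].
  have -> : delta 0 = A 0 - (a 0)%:~R by rewrite mul1r.
  have -> : delta 1 = (a 1)%:~R * (A 0 - (a 0)%:~R) - 1.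
    have -> : q 1 = a 1 by rewrite /cf_den /=; ring.
    have -> : p 1 = a 1 * a 0 + 1 by [].
    by rewrite intrD intrM -[A 0]/alpha; ring.
  transitivity (A 2 * ((a 1)%:~R * (A 0 - (a 0)%:~R) - A 1 * (A 0 - (a 0)%:~R))).
    by rewrite (AS 0%N).
  transitivity (- (A 2 * (A 1 - (a 1)%:~R)) * (A 0 - (a 0)%:~R)); first by ring.
  by rewrite AS; ring.
have -> : delta k.+2 = (a k.+2)%:~R * delta k.+1 + delta k.
  have -> : q k.+2 = a k.+2 * q k.+1 + q k by [].
  have -> : p k.+2 = a k.+2 * p k.+1 + p k by [].
  by move: (q k) (q k.+1) (p k) (p k.+1) => *; rewrite !intrD !intrM; ring.
rewrite -[delta k]opprK -IHk.
transitivity (- (A k.+3 * (A k.+2 - (a k.+2)%:~R)) * delta k.+1); first by ring.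
by rewrite AS; ring.
Qed.

Lemma delta_sign k : 0 < (-1) ^+ k * delta k.
Proof.
elim: k => [|k IHk].
  have := complete_quotient_frac 0; rewrite expr0 mul1r /cf_den /cf_num /=.
  by rewrite mul1r => /andP[].
have A_gt0 : 0 < A k.+2 by apply: lt_trans (complete_quotient_gt1 _).
by rewrite -(pmulr_rgt0 _ A_gt0) mulrCA complete_quotient_delta exprS mulN1r mulrNN.
Qed.

Lemma normr_delta k : `|delta k| = (-1) ^+ k * delta k.
Proof. by rewrite -(gtr0_norm (delta_sign k)) normrM normrX normrN1 expr1n mul1r. Qed.

Lemma normr_delta_le k : `|delta k.+1| <= `|delta k|.
Proof.
rewrite -[in leRHS]normrN -complete_quotient_delta normrM ler_peMl //.
by rewrite (le_trans _ (ler_norm _)) // ltW // complete_quotient_gt1.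
Qed.

(** In [q k.+1 * delta k - q k * delta k.+1] the number [alpha] cancels and the determinant remains;
    opposite signs turn the difference into a sum of absolute values. *)
Lemma normr_delta_den k :
  (q k.+1)%:~R * `|delta k| + (q k)%:~R * `|delta k.+1| = 1.
Proof.
have /(congr1 (fun z : int => z%:~R : R)) := cf_det a k.
rewrite intrB !intrM rmorphN rmorphXn /= rmorphN1 => det.
rewrite !normr_delta exprS.
have sqr1 : (-1 : R) ^+ k * (-1) ^+ k = 1 by rewrite -exprMn mulrNN mulr1 expr1n.
rewrite -[RHS]sqr1 -[X in _ = _ * X]opprK -det; ring.
Qed.

End Convergents.

(** * Multiples of alpha close to an integer *)

Lemma sum_inv_range_ge1 (R : realType) (t : R) (J : nat) :
  (0 < J)%N -> 16 * t <= 3 * J.+1%:R ->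
  1 <= \sum_(j < J | t <= j.+1%:R) (j.+1%:R : R)^-1.
Proof.
move=> J_gt0 le_tJ; have [t_le1|t_gt1] := lerP t 1.
  case: J J_gt0 {le_tJ} => // J _.
  rewrite big_mkcond big_ord_recl /= t_le1 invr1 lerDl sumr_ge0 // => j _.
  by case: ifP => // _; rewrite invr_ge0 ler0n.
have /truncn_itv/andP[le_kt lt_tk] : 0 <= t by lra.
have k_gt0 : (0 < Num.truncn t)%N by rewrite truncn_gt0 ltW.
move: (Num.truncn t) le_kt lt_tk k_gt0 => k le_kt lt_tk k_gt0.
(* Makes room for the range from [k + 1] to [3 k + 2]. For [k = 1] the inequality
   [16 k <= 3 (J + 1)] is enough only because [J] is an integer. *)
have le_kJ : (k + k.+1.*2 <= J)%N.
  suff : (16 * k <= 3 * J.+1)%N by lia.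
  by rewrite -(ler_nat R) !natrM; lra.
apply: le_trans (sum_inv_triple_ge1 k) _.
rewrite [leRHS]big_mkcond -(subnKC le_kJ) [leRHS]big_split_ord.
rewrite [X in _ <= X + _]big_split_ord /=.
set g := fun j : nat => if t <= j.+1%:R then j.+1%:R^-1 else 0 : R.
have g_ge0 j : 0 <= g j by rewrite /g; case: ifP => // _; rewrite invr_ge0 ler0n.
rewrite -[leLHS]add0r -[leLHS]addr0.
apply: lerD; last by apply: sumr_ge0 => j _; apply: g_ge0.
apply: lerD; first by apply: sumr_ge0 => j _; apply: g_ge0.
apply: ler_sum => i _; rewrite addnS addnC ifT //.
by apply: le_trans (ltW lt_tk) _; rewrite ler_nat ltnS leq_addr.
Qed.

(** * Two consecutive convergents with errors [e d] and [- e d'], where [e] is a sign *)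

Section Near.
Context {R : realType}.
Variables (alpha : R) (p p' e : int) (q q' : nat).
Local Notation delta := (q%:R * alpha - p%:~R).
Local Notation delta' := (q'%:R * alpha - p'%:~R).
Local Notation dist n := (dist_int (n%:R * alpha)).

Hypotheses (q_gt0 : (0 < q)%N) (le_qq' : (q <= q')%N) (coprime_pq : coprimez p q).
Hypothesis det : q'%:Z * p - q%:Z * p' = - e.
Hypothesis sqr_e : e * e = 1.
Variable d : R.
Hypotheses (d_gt0 : 0 < d) (deltaE : delta = e%:~R * d).
Variable d' : R.
Hypotheses (d'_ge0 : 0 <= d') (delta'E : delta' = - e%:~R * d').
Hypotheses (le_d'd : d' <= d) (lagrange : q'%:R * d + q%:R * d' = 1).

Let qR_gt0 : 0 < q%:R :> R. Proof. by rewrite ltr0n. Qed.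

Let q'd_le1 : q'%:R * d <= 1.
Proof. by rewrite -[leRHS]lagrange lerDl mulr_ge0 ?ler0n. Qed.

(** With [q'd_le1], the classical [1 / (q + q') <= d <= 1 / q']. *)
Let qq'd_ge1 : 1 <= (q'%:R + q%:R) * d.
Proof. by rewrite -[leLHS]lagrange mulrDl lerD2l ler_pM2l. Qed.

Lemma dist_mul_den j : j%:R * d <= 2^-1 -> dist (j * q) = j%:R * d.
Proof.
move=> small; have sqr_eR : e%:~R * e%:~R = 1 :> R by rewrite -intrM sqr_e.
have norm_e : `|e%:~R| = 1 :> R.
  by apply/eqP; rewrite -sqrp_eq1 ?normr_ge0 // expr2 -normrM sqr_eR normr1.
have norm_jd : `|j%:R * (e%:~R * d)| = j%:R * d.
  by rewrite mulrCA normrM norm_e mul1r ger0_norm // mulr_ge0 ?ler0n // ltW.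
rewrite -norm_jd -dist_int_small ?norm_jd //.
rewrite -(dist_intDz (j%:R * _) (j%:Z * p)) -deltaE; congr dist_int.
by rewrite natrM intrM -pmulrn; ring.
Qed.

(* [n p - m q] can only be [0] or [- e]; the second value is also taken at
   [(q', p')], so [n] then differs from [q'] by a multiple of [q]. *)
Lemma near_cases n : (n < q')%N -> dist n < (2 * q%:R)^-1 ->
  (q %| n)%N /\ dist n = (n %/ q)%:R * d \/
  [/\ (q %| q' - n)%N, ((q' - n) %/ q)%:R * d <= dist n & (q' <= 2 * n)%N].
Proof.
move=> lt_nq'; have [m -> _] := dist_int_attained (n%:R * alpha).
have sqr_eR : e%:~R * e%:~R = 1 :> R by rewrite -intrM sqr_e.
have norm_e : `|e%:~R| = 1 :> R.
  by apply/eqP; rewrite -sqrp_eq1 ?normr_ge0 // expr2 -normrM sqr_eR normr1.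
have normeM (u : R) : `|u| = `|e%:~R * u| by rewrite normrM norm_e mul1r.
pose h : int := n%:Z * p - m * q%:Z.
have hE : q%:R * (n%:R * alpha - m%:~R) = h%:~R + n%:R * (e%:~R * d).
  by rewrite -deltaE /h intrB !intrM -!pmulrn; ring.
have nd_ge0 : 0 <= n%:R * d by rewrite mulr_ge0 ?ler0n // ltW.
have nd_lt1 : n%:R * d < 1.
  by apply: lt_le_trans q'd_le1; rewrite ltr_pM2r // ltr_nat.
rewrite invfM -div1r ltr_pdivlMr // mulrC -[X in X * _](gtr0_norm qR_gt0).
rewrite -normrM hE [`|h%:~R + _|]normeM.
rewrite (_ : e%:~R * (_ + _) = (e * h)%:~R + e%:~R * e%:~R * (n%:R * d)); last first.
  by rewrite intrM; ring.
rewrite sqr_eR mul1r ltr_norml => /andP[lo hi].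
have eh_gt : -2 < e * h by rewrite -(@ltr_int R); lra.
have eh_lt : e * h < 1 by rewrite -(@ltr_int R); lra.
have [eh0|ehN1] : e * h = 0 \/ e * h = -1 by lia.
- left; have h0 : h = 0 by rewrite -[h]mul1r -sqr_e -mulrA eh0 mulr0.
  have /dvdnP[j nE] : (q %| n)%N.
    rewrite -[(q %| n)%N]/(q%:Z %| n%:Z)%Z -(@Gauss_dvdzl _ _ p) 1?coprimez_sym //.
    by apply/dvdzP; exists m; apply/eqP; rewrite -subr_eq0 -/h h0.
  split; first by rewrite nE dvdn_mull.
  rewrite nE mulnK //; apply: (mulfI (lt0r_neq0 qR_gt0)).
  rewrite -[X in X * _ = _](gtr0_norm qR_gt0) -normrM -nE hE h0 add0r normeM.
  rewrite (_ : e%:~R * _ = e%:~R * e%:~R * (n%:R * d)); last by ring.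
  by rewrite sqr_eR mul1r ger0_norm // nE natrM; ring.
- right; have hN : h = - e by rewrite -[h]mul1r -sqr_e -mulrA ehN1 mulrN1.
  have eq_dvd : (q' - n)%:Z * p = (p' - m) * q%:Z.
    apply/eqP; rewrite -subr_eq0 -subzn 1?ltnW //.
    rewrite (_ : _ - _ = (q'%:Z * p - q%:Z * p') - h); last by rewrite /h; ring.
    by rewrite det hN subrr.
  have /dvdnP[i iE] : (q %| q' - n)%N.
    rewrite -[(q %| _)%N]/(q%:Z %| (q' - n)%:Z)%Z -(@Gauss_dvdzl _ _ p) 1?coprimez_sym //.
    by apply/dvdzP; exists (p' - m).
  rewrite iE mulnK //; split; first by rewrite dvdn_mull.
    have mE : p' - m = i%:Z * p.
      have q_neq0 : q%:Z != 0 by rewrite eqz_nat -lt0n.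
      by apply: (mulIf q_neq0); rewrite -eq_dvd iE PoszM; ring.
    have -> : n%:R * alpha - m%:~R = delta' - i%:R * delta.
      have -> : n%:R = q'%:R - i%:R * q%:R :> R.
        by rewrite -natrM -iE natrB 1?ltnW // subKr.
      have -> : m%:~R = p'%:~R - i%:R * p%:~R :> R.
        by rewrite [i%:R]pmulrn -intrM -mE -intrB subKr.
      by ring.
    rewrite normeM delta'E deltaE.
    have -> : e%:~R * (- e%:~R * d' - i%:R * (e%:~R * d)) =
      - ((e%:~R * e%:~R) * (d' + i%:R * d)) by ring.
    rewrite sqr_eR mul1r normrN; apply: le_trans (ler_norm _).
    by rewrite lerDr.
  (* Here [e h = -1], so [n d > 1/2 >= q' d / 2]. *)
  rewrite -(ler_nat R) natrM -(ler_pM2r d_gt0) -mulrA; apply: le_trans q'd_le1 _.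
  by rewrite ehN1 in lo; lra.
Qed.

(** * Sums over the multiples near an integer, cut off at [c / N] *)

Section Threshold.
Variables (c a : R) (N : nat).
Hypotheses (c_gt0 : 0 < c) (a_ge1 : 1 <= a).
Hypotheses (le_qN : (q <= N)%N) (lt_Nq' : (N < q')%N).
Hypothesis q'_le : q'%:R + q%:R <= 3 * a * q%:R.

Let NR_gt0 : 0 < N%:R :> R.
Proof. by rewrite ltr0n; apply: leq_trans le_qN. Qed.

Let a_ge0 : 0 <= a. Proof. exact: le_trans a_ge1. Qed.

Let a3_ge1 : 1 <= 3 * a.
Proof. by apply: le_trans a_ge1 _; rewrite ler_peMl // ler1n. Qed.

Let quot_le : (N %/ q)%:R <= N%:R / q%:R :> R.
Proof. by rewrite ler_pdivlMr // -natrM ler_nat leq_trunc_div. Qed.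

Let qd_ge : 1 <= 3 * a * q%:R * d.
Proof. by apply: le_trans qq'd_ge1 _; rewrite ler_pM2r. Qed.

Let le1d : d^-1 <= 2 * q'%:R.
Proof.
rewrite -div1r ler_pdivrMr //; apply: le_trans qq'd_ge1 _.
by rewrite ler_pM2r // mulr_natl mulr2n lerD2l ler_nat.
Qed.

(** Interpolating with the threshold replaces [1 / j] by a multiple of [1 / sqrt j]. Summing up to
    [N / q] gives at most [2 N / sqrt (c q d)], and [q d >= 1 / (3 a)]. *)
Lemma multiples_sum_le :
  \sum_(j < N %/ q | c / N%:R <= j.+1%:R * d) (j.+1%:R * d)^-1
  <= 2 * Num.sqrt (3 / c) * (Num.sqrt a * N%:R).
Proof.
have Ncd_ge0 : 0 <= N%:R / (c * d) by rewrite ltW // divr_gt0 ?mulr_gt0.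
pose w := Num.sqrt (N%:R / (c * d)).
have w_ge0 : 0 <= w by rewrite sqrtr_ge0.
apply: le_trans (_ : \sum_(j < N %/ q) w * (Num.sqrt j.+1%:R)^-1 <= _).
  rewrite big_mkcond; apply: ler_sum => j _; case: ifP => [le_jd|_]; last first.
    by rewrite mulr_ge0 // invr_ge0 sqrtr_ge0.
  have jd_gt0 : 0 < j.+1%:R * d by rewrite mulr_gt0 ?ltr0n.
  (* [1 / y <= sqrt (1 / y) * sqrt (N / c)] as soon as [c / N <= y] *)
  have dE : (j.+1%:R * d)^-1 = Num.sqrt (j.+1%:R * d)^-1 * Num.sqrt (j.+1%:R * d)^-1.
    by rewrite -expr2 sqr_sqrtr // invr_ge0 ltW.
  rewrite dE; apply: le_trans (_ : Num.sqrt (j.+1%:R * d)^-1 * Num.sqrt (N%:R / c) <= _).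
    rewrite ler_wpM2l ?sqrtr_ge0 // ler_wsqrtr // -invf_div lef_pV2 ?posrE //.
    by rewrite divr_gt0.
  have inv_ge0 : 0 <= (j.+1%:R * d)^-1 by rewrite invr_ge0 ltW.
  rewrite -sqrtrV ?ler0n // -!sqrtrM //.
  rewrite ler_wsqrtr // le_eqVlt; apply/orP; left; apply/eqP.
  by rewrite !invfM; ring.
rewrite -mulr_sumr; apply: le_trans (ler_wpM2l w_ge0 (sum_inv_sqrt_le _)) _.
have -> : 2 * Num.sqrt (3 / c) * (Num.sqrt a * N%:R) =
  2 * (Num.sqrt (3 / c) * Num.sqrt a * N%:R) by ring.
rewrite mulrCA ler_pM2l // -[X in _ <= _ * X](ger0_norm (ler0n _ _)) -sqrtr_sqr.
have c3_ge0 : 0 <= 3 / c by rewrite divr_ge0 ?ler0n ?ltW.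
have c3a_ge0 : 0 <= 3 / c * a by rewrite mulr_ge0.
rewrite /w -!sqrtrM // ler_wsqrtr //.
apply: le_trans (_ : N%:R / (c * d) * (N%:R / q%:R) <= _).
  by rewrite ler_wpM2l.
have -> : N%:R / (c * d) * (N%:R / q%:R) = N%:R ^+ 2 / c / (q%:R * d).
  by field; rewrite !gt_eqF.
have -> : 3 / c * a * N%:R ^+ 2 = N%:R ^+ 2 / c * (3 * a).
  by field; rewrite !gt_eqF.
have N2c_ge0 : 0 <= N%:R ^+ 2 / c by rewrite divr_ge0 ?sqr_ge0 ?ltW.
rewrite ler_wpM2l // -div1r ler_pdivrMr ?mulr_gt0 //.
by rewrite mulrA.
Qed.

(** Extending the range to all [n < q'] and reversing it leaves [1 / d <= 2 q'] times a harmonic sum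
    of length at most [q' / q <= 3 a]. *)
Lemma reflected_sum_le :
  \sum_(i < N | (q %| q' - i.+1)%N) (((q' - i.+1) %/ q)%:R * d)^-1
  <= 2 * q'%:R * (1 + ln (3 * a)).
Proof.
pose f (j : nat) : R := (j%:R * d)^-1.
have f_ge0 j : 0 <= f j by rewrite invr_ge0 mulr_ge0 ?ler0n // ltW.
pose M := q'.-1; have q'E : q' = M.+1 by rewrite prednK // (leq_trans q_gt0).
apply: le_trans (_ : \sum_(i < M | (q %| q' - i.+1)%N) f ((q' - i.+1) %/ q)%N <= _).
  have le_NM : (N <= M)%N by rewrite -ltnS -q'E.
  rewrite -(subnKC le_NM) [leRHS]big_mkcond big_split_ord /= -big_mkcond lerDl.
  by apply: sumr_ge0 => i _; case: ifP.
rewrite (reindex_inj rev_ord_inj) /=.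
have rev_eq (i : 'I_M) : (q' - (M - i.+1).+1 = i.+1)%N.
  by rewrite subnSK // q'E subSn ?leq_subr // subKn // ltnW.
rewrite (eq_bigl (fun i : 'I_M => (q %| i.+1)%N)) => [|i]; last by rewrite rev_eq.
rewrite (eq_bigr (fun i : 'I_M => f (i.+1 %/ q)%N)) => [|i _]; last by rewrite rev_eq.
rewrite sum_dvdn // /f; under eq_bigr do rewrite invfM.
rewrite -mulr_suml mulrC; apply: ler_pM => //.
- by rewrite invr_ge0 ltW.
- by apply: sumr_ge0 => i _; rewrite invr_ge0 ler0n.
case E : (M %/ q)%N => [|m]; first by rewrite big_ord0 addr_ge0 ?ln_ge0.
apply: le_trans (harmonic_le _) _; rewrite lerD2l ler_ln ?posrE ?ltr0n ?(lt_le_trans ltr01) //.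
rewrite -(ler_pM2r qR_gt0); apply: le_trans q'_le; rewrite -natrM -natrD ler_nat.
rewrite -E; apply: leq_trans (leq_trunc_div _ _) _.
by rewrite q'E (leq_trans (leqnSn M)) ?leq_addr.
Qed.

Lemma near_sum_le :
  \sum_(i < N | (c / N%:R <= dist i.+1) && (dist i.+1 < (2 * q%:R)^-1)) (dist i.+1)^-1
  <= 2 * Num.sqrt (3 / c) * (Num.sqrt a * N%:R) + 4 * N%:R * (1 + ln (3 * a)).
Proof.
have cN_gt0 : 0 < c / N%:R by rewrite divr_gt0.
have ln3a_ge0 : 0 <= ln (3 * a) by apply: ln_ge0.
pose f (j : nat) : R := if c / N%:R <= j%:R * d then (j%:R * d)^-1 else 0.
(* The guard holds whenever [near_cases] yields its second alternative, and it turns the factor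
   [2 q'] of [reflected_sum_le] into [4 N]. *)
pose g (j : nat) : R := if (q' <= 2 * N)%N then (j%:R * d)^-1 else 0.
have jd_ge0 j : 0 <= j%:R * d by rewrite mulr_ge0 ?ler0n // ltW.
have f_ge0 j : 0 <= f j by rewrite /f; case: ifP; rewrite ?invr_ge0.
have g_ge0 j : 0 <= g j by rewrite /g; case: ifP; rewrite ?invr_ge0.
apply: le_trans (_ : \sum_(i < N | (q %| i.+1)%N) f (i.+1 %/ q)%N
  + \sum_(i < N | (q %| q' - i.+1)%N) g ((q' - i.+1) %/ q)%N <= _).
  rewrite big_mkcond [X in _ <= X + _]big_mkcond [X in _ <= _ + X]big_mkcond.
  rewrite -big_split /=; apply: ler_sum => i _.
  have lt_iq' : (i.+1 < q')%N by apply: leq_ltn_trans lt_Nq'.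
  case: ifP => [/andP[far near]|_]; last first.
    by apply: addr_ge0; case: ifP.
  have [[qi iE]|[qi le_i le_q']] := near_cases lt_iq' near; rewrite qi.
    rewrite iE in far *; rewrite {1}/f far lerDl.
    by case: ifP.
  have gE j : g j = (j%:R * d)^-1.
    by rewrite /g ifT // (leq_trans le_q') // leq_mul2l ltn_ord.
  rewrite gE.
  apply: ler_wpDl; first by case: ifP.
  rewrite lef_pV2 ?posrE //; first exact: lt_le_trans far.
  by rewrite mulr_gt0 // ltr0n divn_gt0 // dvdn_leq // subn_gt0.
apply: lerD.
  by rewrite (sum_dvdn f N q_gt0); apply: le_trans multiples_sum_le; rewrite [leRHS]big_mkcond.
rewrite /g; case: (leqP q' (2 * N)) => le_q'; last first.
  by rewrite big1 // !mulr_ge0 ?addr_ge0 ?ler0n.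
apply: le_trans reflected_sum_le _; apply: ler_wpM2r; first by rewrite addr_ge0.
by rewrite -!natrM ler_nat -[4%N]/(2 * 2)%N -mulnA leq_mul2l.
Qed.

(** A multiple [j q] with [j d >= 1 / (2 q)] may be absent from the near sum, but then
    [1 / (j d) <= 2 q]. Adding [2 q] for every [j <= N / q] costs at most [2 N] and restores these
    terms; the sum of the admissible [1 / j] is at least 1, and [1 / d >= q']. *)
Lemma near_sum_ge :
  4 * Num.sqrt (c * a) * q%:R <= N%:R ->
  q'%:R - 2 * N%:R <=
  \sum_(i < N | (c / N%:R <= dist i.+1) && (dist i.+1 < (2 * q%:R)^-1)) (dist i.+1)^-1.
Proof.
move=> large.
have q2_gt0 : 0 < (2 * q%:R)^-1 :> R by rewrite invr_gt0 mulr_gt0.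
have inv_jd j : (j.+1%:R * d)^-1 = j.+1%:R^-1 * d^-1 by rewrite invfM.
have jd_gt0 j : 0 < j.+1%:R * d by rewrite mulr_gt0 ?ltr0n.
pose f (j : nat) : R :=
  if (c / N%:R <= j%:R * d) && (j%:R * d < (2 * q%:R)^-1) then (j%:R * d)^-1 else 0.
apply: le_trans (_ : \sum_(j < N %/ q) f j.+1 <= _); last first.
  rewrite -(sum_dvdn f N q_gt0) [leLHS]big_mkcond [leRHS]big_mkcond /=.
  apply: ler_sum => i _; case: ifP => [/dvdnP[j iE]|_]; last first.
    by case: ifP => // _; rewrite invr_ge0 dist_int_ge0.
  rewrite iE mulnK // /f; case: ifP => [/andP[ge_j lt_j]|_]; last first.
    by case: ifP => // _; rewrite invr_ge0 dist_int_ge0.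
  rewrite dist_mul_den ?ge_j ?lt_j //; apply: ltW (lt_le_trans lt_j _).
  by rewrite lef_pV2 ?posrE ?mulr_gt0 // ler_peMr // ler1n.
have tail : \sum_(j < N %/ q) (2 * q%:R) <= 2 * N%:R :> R.
  rewrite sumr_const card_ord -[(2 * q%:R) *+ _]mulr_natr -mulrA ler_pM2l //.
  by rewrite -natrM ler_nat mulnC leq_trunc_div.
rewrite lerBlDr; apply: le_trans (lerD (lexx _) tail); rewrite -big_split /=.
apply: le_trans (_ : \sum_(j < N %/ q | c / (N%:R * d) <= j.+1%:R) j.+1%:R^-1 * q'%:R <= _).
  rewrite -mulr_suml ler_peMl ?ler0n // sum_inv_range_ge1 ?divn_gt0 //.
  have large2 : 16 * (c * a) * q%:R ^+ 2 <= N%:R ^+ 2.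
    have ca_ge0 : 0 <= c * a by rewrite mulr_ge0 // ltW.
    rewrite -[c * a]sqr_sqrtr // (_ : 16 * _ * _ = (4 * Num.sqrt (c * a) * q%:R) ^+ 2).
      by rewrite ler_pXn2r ?nnegrE ?ler0n ?mulr_ge0 ?sqrtr_ge0.
    by ring.
  rewrite mulrA ler_pdivrMr ?mulr_gt0 //.
  have quot_lt : N%:R <= (N %/ q).+1%:R * q%:R :> R.
    by rewrite -natrM ler_nat ltnW // ltn_ceil.
  (* With [J = N %/ q], the chain is [16 c q <= 48 c a q^2 d <= 3 d N^2 <= 3 d N q (J + 1)]. *)
  rewrite -(ler_pM2r qR_gt0).
  apply: le_trans (_ : 3 * d * N%:R ^+ 2 <= _).
    apply: le_trans (_ : 3 * d * (16 * (c * a) * q%:R ^+ 2) <= _); last first.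
      by rewrite ler_pM2l ?mulr_gt0.
    rewrite (_ : 3 * d * _ = 16 * c * q%:R * (3 * a * q%:R * d)); last by ring.
    by rewrite ler_peMr // !mulr_ge0 ?ler0n // ltW.
  rewrite (_ : _ * _ * q%:R = 3 * d * (N%:R * ((N %/ q).+1%:R * q%:R))); last by ring.
  by rewrite ler_pM2l ?mulr_gt0 // expr2 ler_pM2l.
rewrite big_mkcond; apply: ler_sum => j _.
case: ifP => [ge_j|_]; last first.
  by rewrite addr_ge0 ?mulr_ge0 ?ler0n // /f; case: ifP => // _; rewrite invr_ge0 ltW.
apply: le_trans (_ : (j.+1%:R * d)^-1 <= _).
  rewrite inv_jd ler_pM2l ?invr_gt0 ?ltr0n // -[leRHS]div1r ler_pdivlMr //.
have far : c / N%:R <= j.+1%:R * d.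
  rewrite ler_pdivrMr // mulrAC -mulrA -ler_pdivrMr //.
  by rewrite mulr_gt0.
rewrite /f far; case: ltP => /= [_|ge_jd]; first by rewrite lerDl mulr_ge0 ?ler0n.
by rewrite add0r -[leRHS]invrK lef_pV2 ?posrE.
Qed.

End Threshold.

End Near.

(** * The smoothed sum *)

Section SmoothedSum.
Context {R : realType}.
Variable alpha : R.
Hypothesis alpha_irr : irrational alpha.

Local Notation a := (partial_quotient alpha).
Local Notation p := (cf_num a).
Local Notation q := (cf_den a).
Local Notation dist n := (dist_int (n%:R * alpha)).

Lemma cf_den_natE k : exists2 Q : nat, (0 < Q)%N & q k = Q%:Z.
Proof.
have := cf_den_ge1 alpha_irr k; case: (q k) => // Q; by exists Q.
Qed.

Lemma convergent_approx k (Q : nat) : q k = Q%:Z ->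
  `|Q%:R * alpha - (p k)%:~R| <= Q%:R^-1.
Proof.
move=> qE; have Q_gt0 : 0 < Q%:R :> R.
  by rewrite ltr0n -ltz_nat -qE gtz0_ge1 cf_den_ge1.
have := normr_delta_den alpha_irr k; rewrite qE -pmulrn => lagrange.
rewrite -[leRHS]div1r ler_pdivlMr // -[leRHS]lagrange mulrC.
apply: ler_wpDr; first by rewrite mulr_ge0 ?ler0n.
by rewrite ler_wpM2r // pmulrn ler_int -qE cf_den_mono.
Qed.

Lemma sum_partial_quotientsS k :
  sum_partial_quotients alpha k.+1 = sum_partial_quotients alpha k + a k.+1.
Proof. by rewrite /sum_partial_quotients big_nat_recr. Qed.

Lemma sum_partial_quotients_ge0 k : 0 <= sum_partial_quotients alpha k.
Proof.
elim: k => [|k IHk]; first by rewrite /sum_partial_quotients big_nil.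
rewrite sum_partial_quotientsS addr_ge0 //.
exact: le_trans (partial_quotient_ge1 alpha_irr k).
Qed.

(* Cutting [0, L) into blocks of lengths [q_(k-1), q_(k-2), ...] uses at most
   [a_i] blocks of length [q_(i-1)]. *)
Lemma sum_inv_dist_approx (tau : R) k : 0 < tau -> forall L n0,
  L%:Z < q k ->
  `|\sum_(i < L) (dist (n0 + i) + tau)^-1 - L%:R * (2 * ln (1 + tau^-1))|
  <= (sum_partial_quotients alpha k)%:~R * (6 / tau) + 2 * L%:R.
Proof.
move=> tau_gt0; elim: k => [|k IHk] L n0 lt_L.
  have -> : L = 0%N by case: L lt_L.
  rewrite big_ord0 !mul0r subrr normr0 mulr0 addr0 mulr_ge0 //.
    by rewrite ler0z sum_partial_quotients_ge0.
  by rewrite divr_ge0 ?ltW.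
have [Q Q_gt0 qE] := cf_den_natE k.
have cop : coprimez (p k) Q by rewrite -qE cf_coprime.
have le_div : ((L %/ Q)%N)%:Z <= a k.+1.
  have le_LQ : ((L %/ Q) * Q)%N%:Z <= L%:Z by rewrite lez_nat leq_trunc_div.
  have := lt_le_trans lt_L (cf_denS_le alpha_irr k); rewrite qE => lt_LaQ.
  have := le_lt_trans le_LQ lt_LaQ.
  by rewrite PoszM ltr_pM2r ?ltz_nat // ltzD1.
have lt_mod : ((L %% Q)%N)%:Z < q k by rewrite qE ltz_nat ltn_mod.
have split_sum (F : nat -> R) m n : L = (m + n)%N ->
    \sum_(i < L) F i = \sum_(i < m) F i + \sum_(i < n) F (m + i)%N.
  by move=> ->; rewrite big_split_ord.
have sumE : \sum_(i < L) (dist (n0 + i) + tau)^-1 =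
    \sum_(i < L %/ Q * Q) (dist (n0 + i) + tau)^-1 +
    \sum_(i < L %% Q) (dist (n0 + L %/ Q * Q + i) + tau)^-1.
  rewrite (split_sum (fun i => (dist (n0 + i) + tau)^-1) _ _ (divn_eq L Q)).
  by congr (_ + _); apply: eq_bigr => i _; rewrite addnA.
have := block_sums_inv Q_gt0 cop (convergent_approx qE) (L %/ Q) n0 tau_gt0.
have := IHk _ (n0 + L %/ Q * Q)%N lt_mod.
have {le_div} : (L %/ Q)%:R <= (a k.+1)%:~R :> R by rewrite pmulrn ler_int.
have LE : L%:R = (L %/ Q * Q)%:R + (L %% Q)%:R :> R.
  by rewrite -natrD -divn_eq.
have tau6_gt0 : 0 < 6 / tau by rewrite divr_gt0.
rewrite sum_partial_quotientsS intrD LE natrM.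
rewrite sumE.
move: (2 * ln _) (6 / tau) tau6_gt0 (\sum_(i < _ * _) _) (\sum_(i < _ %% _) _).
move=> I u u_gt0 S1 S2 le_a le2 le1.
rewrite mulrDl opprD addrACA; apply: le_trans (ler_normD _ _) _.
apply: le_trans (lerD le1 le2) _.
have := ler_wpM2r (ltW u_gt0) le_a.
by lra.
Qed.

(* With [tau = s / N], the main term [2 N ln (1 + 1 / tau)] is
   [2 N ln N + O(N ln s)] and the error [6 s / tau] is [6 N]. *)
Lemma smoothed_sum_approx k N (s : R) :
  (0 < N)%N -> N%:Z < q k -> s = (sum_partial_quotients alpha k)%:~R -> 1 <= s ->
  `|\sum_(i < N) (dist i.+1 + s / N%:R)^-1 - 2 * N%:R * ln N%:R|
  <= 10 * N%:R * log_err s.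
Proof.
move=> N_gt0 lt_N sE s_ge1; have NR_gt0 : 0 < N%:R :> R by rewrite ltr0n.
have NR_ge1 : 1 <= N%:R :> R by rewrite ler1n.
have s_gt0 : 0 < s by apply: lt_le_trans s_ge1.
have := sum_inv_dist_approx (divr_gt0 s_gt0 NR_gt0) 1 lt_N; rewrite -sE.
have -> : s * (6 / (s / N%:R)) = 6 * N%:R by field; rewrite !gt_eqF.
move: (\sum_(i < N) _) => S.
have l_ge1 : 1 <= log_err s.
  by rewrite -[leLHS](@expRK R) ler_ln ?posrE ?lt_max ?expR_gt0 // le_max lexx.
have l_ge : ln s <= log_err s.
  by rewrite ler_ln ?posrE ?lt_max ?expR_gt0 // le_max lexx orbT.
have tau_inv : (s / N%:R)^-1 = N%:R / s by rewrite invf_div.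
have lnE : ln (1 + (s / N%:R)^-1) = ln N%:R + ln (N%:R^-1 + s^-1).
  rewrite -lnM ?posrE ?addr_gt0 ?invr_gt0 //; congr ln; rewrite tau_inv.
  by field; rewrite !gt_eqF.
(* [1 / s <= 1 / N + 1 / s <= 2] confines this logarithm to [[- ln s, 1]]. The final 10 is [6 + 2]
   from the blocks plus 2 from here. *)
have hi : ln (N%:R^-1 + s^-1) <= 1.
  apply: le_trans (_ : ln (1 + 1) <= _); last by apply: le_ln1Dx; lra.
  by rewrite ler_ln ?posrE ?addr_gt0 ?invr_gt0 // lerD // invf_le1.
have lo : - ln s <= ln (N%:R^-1 + s^-1).
  rewrite -lnV ?posrE // ler_ln ?posrE ?addr_gt0 ?invr_gt0 //.
  by rewrite lerDr invr_ge0 ltW.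
rewrite lnE; move: (ln N%:R) (ln (_ + _)) hi lo => lnN v hi lo.
rewrite !ler_norml => /andP[ge_S le_S]; apply/andP.
have : N%:R * v <= N%:R * log_err s by rewrite ler_pM2l // (le_trans hi).
have : N%:R * (- log_err s) <= N%:R * v.
  by rewrite ler_pM2l // (le_trans _ lo) // lerN2.
have : N%:R * 1 <= N%:R * log_err s by rewrite ler_pM2l.
move: (log_err s) le_S ge_S; clear => l.
by split; lra.
Qed.

End SmoothedSum.

(** * Undoing the smoothing *)

(** Both bounds hold term by term. In the lower one, [1 / tau] outweighs the smoothed term when
    [x i < v]; when [x i >= v] the term is above both [u] and [t], and smoothing only decreases
    it. *)
Lemma threshold_sum_bounds (R : realType) (N : nat) (x : 'I_N -> R) (t u v tau : R) :
  (forall i, 0 <= x i) -> 0 < tau -> 0 < t -> u <= v -> t <= v ->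
  \sum_(i < N) (x i + tau)^-1 - tau^-1 * \sum_(i < N | x i < v) 1
    + \sum_(i < N | (u <= x i) && (x i < t)) (x i)^-1
  <= \sum_(i < N | u <= x i) (x i)^-1
  <= \sum_(i < N) (x i + tau)^-1
    + \sum_(i < N | t <= x i) ((x i)^-1 - (x i + tau)^-1)
    + \sum_(i < N | (u <= x i) && (x i < t)) (x i)^-1.
Proof.
move=> x_ge0 tau_gt0 t_gt0 le_uv le_tv.
rewrite mulr_sumr -sumrN.
rewrite [X in _ + X + _ <= _]big_mkcond [X in _ + X <= _]big_mkcond.
rewrite [X in _ <= X <= _]big_mkcond [X in _ <= _ + X + _]big_mkcond.
rewrite [X in _ <= _ + X]big_mkcond -!big_split /=.
apply/andP; split; apply: ler_sum => i _.
all: have xtau_ge0 : 0 <= (x i + tau)^-1 by rewrite invr_ge0 addr_ge0 // ltW.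
all: have le_tau : (x i + tau)^-1 <= tau^-1
  by rewrite lef_pV2 ?posrE ?ltr_wpDl // lerDr.
all: have x_inv_ge0 : 0 <= (x i)^-1 by rewrite invr_ge0.
all: have le_x : t <= x i -> (x i + tau)^-1 <= (x i)^-1
  by move=> le_t; rewrite lef_pV2 ?posrE ?ltr_wpDl // ?lerDl ?ltW //;
     apply: lt_le_trans le_t.
all: have [le_u|lt_u] := leP u (x i); have [le_t|lt_t] := leP t (x i) => /=.
all: have [le_v|lt_v] := leP v (x i) => /=.
all: try (have := le_x le_t); try lra.
Qed.

(** Places the convergents of index [K] and [K + 1] in the setting of two consecutive convergents,
    with sign [e = (-1)^K]. *)
Lemma convergent_near_sum_bounds (R : realType) (alpha c : R) K (N q q' : nat) :
  irrational alpha -> 0 < c ->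
  cf_den (partial_quotient alpha) K = q%:Z ->
  cf_den (partial_quotient alpha) K.+1 = q'%:Z ->
  (q <= N)%N -> (N < q')%N ->
  let a : R := (partial_quotient alpha K.+1)%:~R in
  let near := \sum_(i < N | (c / N%:R <= dist_int (i.+1%:R * alpha)) &&
      (dist_int (i.+1%:R * alpha) < (2 * q%:R)^-1)) (dist_int (i.+1%:R * alpha))^-1 in
  near <= 2 * Num.sqrt (3 / c) * (Num.sqrt a * N%:R) + 4 * N%:R * (1 + ln (3 * a)) /\
  (4 * Num.sqrt (c * a) * q%:R <= N%:R -> q'%:R - 2 * N%:R <= near).
Proof.
move=> alpha_irr c_gt0 qE q'E le_qN lt_Nq' a near.
have q_gt0 : (0 < q)%N by rewrite -ltz_nat -qE gtz0_ge1 cf_den_ge1.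
have a_ge1 : 1 <= a by rewrite ler1z partial_quotient_ge1.
have qR_gt0 : 0 < q%:R :> R by rewrite ltr0n.
have le_q'q : q'%:R <= (a + 1) * q%:R :> R.
  have := cf_denS_le alpha_irr K; rewrite qE q'E -(ler_int R).
  by rewrite intrM intrD -!pmulrn.
have q'q_le : q'%:R + q%:R <= 3 * a * q%:R.
  have := ler_pM2r qR_gt0 1 a; rewrite a_ge1 mul1r; lra.
have le_qq' : (q <= q')%N by rewrite ltnW // (leq_ltn_trans le_qN).
have cop : coprimez (cf_num (partial_quotient alpha) K) q by rewrite -qE cf_coprime.
have sqr_e : (-1 : int) ^+ K * (-1) ^+ K = 1 by rewrite -exprMn mulrNN mulr1 expr1n.
pose e : int := (-1) ^+ K.
pose p k := cf_num (partial_quotient alpha) k.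
have det : q'%:Z * p K - q%:Z * p K.+1 = - e by rewrite -qE -q'E cf_det.
pose d := `|q%:R * alpha - (p K)%:~R|; pose d' := `|q'%:R * alpha - (p K.+1)%:~R|.
have d_gt0 : 0 < d.
  by have := delta_sign alpha_irr K; rewrite -normr_delta // qE.
have eR : e%:~R = (-1) ^+ K :> R by rewrite rmorphXn /= rmorphN1.
have sqr_eR : (-1 : R) ^+ K * (-1) ^+ K = 1 by rewrite -exprMn mulrNN mulr1 expr1n.
have dE : q%:R * alpha - (p K)%:~R = e%:~R * d.
  have := normr_delta alpha_irr K; rewrite qE -pmulrn -/(p K) -/d => ->.
  by rewrite eR mulrA sqr_eR mul1r.
have d'E : q'%:R * alpha - (p K.+1)%:~R = - e%:~R * d'.
  have := normr_delta alpha_irr K.+1; rewrite q'E -pmulrn -/(p K.+1) -/d' => ->.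
  by rewrite eR exprS mulN1r mulrA mulrNN sqr_eR mul1r.
have le_d'd : d' <= d by have := normr_delta_le alpha_irr K; rewrite qE q'E.
have lagrange : q'%:R * d + q%:R * d' = 1.
  by have := normr_delta_den alpha_irr K; rewrite qE q'E.
split.
  exact: (near_sum_le q_gt0 le_qq' cop det sqr_e d_gt0 dE (normr_ge0 _) d'E le_d'd
    lagrange c_gt0 a_ge1 le_qN lt_Nq' q'q_le).
exact: (near_sum_ge q_gt0 sqr_e d_gt0 dE (normr_ge0 _) le_d'd lagrange
  c_gt0 a_ge1 le_qN q'q_le).
Qed.

Theorem theorem3 (R : realType) (c : R) (hc : 0 < c) :
  exists C1 C2 : R,
    forall (alpha : R), irrational alpha ->
    forall (K N : nat),
      convergent_den alpha K <= N%:Z ->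
      N%:Z < convergent_den alpha K.+1 ->
      `| recip_dist_sum alpha c N - 2 * N%:R * ln N%:R |
        <= C1 * ((Num.sqrt (partial_quotient alpha K.+1)%:~R
                  + log_err (sum_partial_quotients alpha K.+1)%:~R) * N%:R)
      /\
      (4 * Num.sqrt (c * (partial_quotient alpha K.+1)%:~R)
         * (convergent_den alpha K)%:~R <= N%:R ->
       2 * N%:R * ln N%:R + (convergent_den alpha K.+1)%:~R
         - C2 * (log_err (sum_partial_quotients alpha K.+1)%:~R * N%:R)
       <= recip_dist_sum alpha c N).
Proof.
pose C0 : R := 2 * Num.sqrt (3 / c).
pose C : R := 16 * (c + 5) ^+ 2.
have C0_ge0 : 0 <= C0 by rewrite mulr_ge0 ?sqrtr_ge0.
have C_ge0 : 0 <= C by rewrite mulr_ge0 ?sqr_ge0.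
(* [346 = 10 + 32 (1 + 9) + 4 (1 + 3)]: smoothed sum, far terms, reflected near terms.
   [12 = 10 + 2]: smoothed sum and the loss [2 N] in the near sum. [C0] comes from the multiples of
   [q] and [C] from the points below [(c + 1) / q]. *)
exists (346 + C0 + C), (12 + C) => alpha alpha_irr K N.
rewrite !convergent_denE //.
have [q q_gt0 qE] := cf_den_natE alpha_irr K.
have [q' _ q'E] := cf_den_natE alpha_irr K.+1.
rewrite qE q'E -!pmulrn lez_nat ltz_nat => le_qN lt_Nq'.
have [near_le near_ge] := convergent_near_sum_bounds alpha_irr hc qE q'E le_qN lt_Nq'.
set a : R := (partial_quotient alpha K.+1)%:~R in near_le near_ge *.
set s : R := (sum_partial_quotients alpha K.+1)%:~R.
have a_ge1 : 1 <= a by rewrite ler1z partial_quotient_ge1.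
have le_as : a <= s.
  by rewrite ler_int sum_partial_quotientsS lerDr sum_partial_quotients_ge0.
have s_ge1 := le_trans a_ge1 le_as.
have s_gt0 : 0 < s by apply: lt_le_trans s_ge1.
have N_gt0 : (0 < N)%N by apply: leq_trans le_qN.
have NR_gt0 : 0 < N%:R :> R by rewrite ltr0n.
have qR_gt0 : 0 < q%:R :> R by rewrite ltr0n.
have le_qNR : q%:R <= N%:R :> R by rewrite ler_nat.
have Nq_le : N%:R / q%:R <= 2 * s.
  rewrite ler_pdivrMr //.
  have : N%:R <= (a + 1) * q%:R :> R.
    apply: le_trans (_ : q'%:R <= _); first by rewrite ler_nat ltnW.
    have := cf_denS_le alpha_irr K; rewrite qE q'E -(ler_int R).
    by rewrite intrM intrD -!pmulrn.
  by move=> /le_trans; apply; rewrite ler_pM2r // mulr_natl mulr2n lerD.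
set l := log_err s.
have l_ge1 : 1 <= l.
  by rewrite -[leLHS](@expRK R) ler_ln ?posrE ?lt_max ?expR_gt0 // le_max lexx.
have ln_s_le : ln s <= l.
  by rewrite ler_ln ?posrE ?lt_max ?expR_gt0 // le_max lexx orbT.
have -> : recip_dist_sum alpha c N =
    \sum_(i < N | c / N%:R <= dist_int (i.+1%:R * alpha))
      (dist_int (i.+1%:R * alpha))^-1.
  by rewrite /recip_dist_sum big_add1 big_mkord.
pose tau := s / N%:R; have tau_gt0 : 0 < tau by rewrite divr_gt0.
have cop : coprimez (cf_num (partial_quotient alpha) K) q by rewrite -qE cf_coprime.
have approx := convergent_approx alpha_irr qE.
have q2_gt0 : 0 < (2 * q%:R)^-1 :> R by rewrite invr_gt0 mulr_gt0.
(* The bound [(c + 1) / q] is chosen to dominate both the threshold [c / N], by [q <= N], and the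
   cut [1 / (2 q)]. *)
have le_uv : c / N%:R <= (c + 1) / q%:R.
  by apply: ler_pM; rewrite ?invr_ge0 ?ler0n ?(ltW hc) ?lef_pV2 ?posrE ?lerDl.
have le_tv : (2 * q%:R)^-1 <= (c + 1) / q%:R.
  rewrite invfM ler_pM2r ?invr_gt0 //; lra.
have := @threshold_sum_bounds R N (fun i => dist_int (i.+1%:R * alpha))
  _ _ _ tau (fun=> dist_int_ge0 _) tau_gt0 q2_gt0 le_uv le_tv.
have smooth : `|\sum_(i < N) (dist_int (i.+1%:R * alpha) + tau)^-1
    - 2 * N%:R * ln N%:R| <= 10 * N%:R * l.
  by apply: (@smoothed_sum_approx _ _ alpha_irr K.+1) => //; rewrite q'E ltz_nat.
have far := far_sum_le q_gt0 cop approx le_qN (ltW tau_gt0).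
have c1_ge0 : 0 <= c + 1 by rewrite addr_ge0 ?ltW.
have count := near_count_le q_gt0 cop approx le_qN c1_ge0.
have near_ge0 : 0 <= \sum_(i < N | (c / N%:R <= dist_int (i.+1%:R * alpha)) &&
      (dist_int (i.+1%:R * alpha) < (2 * q%:R)^-1)) (dist_int (i.+1%:R * alpha))^-1.
  by apply: sumr_ge0 => i _; rewrite invr_ge0 dist_int_ge0.
(* Since [q tau <= s], this is at most [ln 9 + ln s <= 8 + l <= 9 l]. *)
have ln_far : ln (1 + 8 * q%:R * tau) <= 9 * l.
  have qtau_le : q%:R * tau <= s.
    by rewrite /tau mulrCA ler_piMr ?(ltW s_gt0) // ler_pdivrMr // mul1r.
  have qtau_ge0 : 0 <= q%:R * tau by rewrite mulr_ge0 ?ler0n ?ltW.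
  apply: le_trans (_ : ln (9 * s) <= _); first by rewrite ler_ln ?posrE; lra.
  have : ln (1 + 8) <= 8 :> R by apply: le_ln1Dx; lra.
  by rewrite lnM ?posrE // (_ : 1 + 8 = 9); [lra | ring].
have ln_near : ln (3 * a) <= 3 * l.
  apply: le_trans (_ : ln (3 * s) <= _); first by rewrite ler_ln ?posrE; lra.
  have : ln (1 + 2) <= 2 :> R by apply: le_ln1Dx; lra.
  by rewrite lnM ?posrE // (_ : 1 + 2 = 3); [lra | ring].
have {}far := le_trans far (ler_wpM2l (mulr_ge0 (ler0n _ 32) (ler0n _ N))
  (lerD (lexx 1) ln_far)).
have {}near_le := le_trans near_le (lerD (lexx _)
  (ler_wpM2l (mulr_ge0 (ler0n _ 4) (ler0n _ N)) (lerD (lexx 1) ln_near))).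
(* The factor [s] cancels: [1 / tau = N / s], while the count is [O(N / q)] and [N / q <= 2 s]. *)
have {}count : tau^-1 * \sum_(i < N | dist_int (i.+1%:R * alpha) < (c + 1) / q%:R) 1
    <= C * N%:R.
  have -> : C * N%:R = tau^-1 * (8 * (c + 1 + 4) ^+ 2 * (2 * s)).
    by rewrite /C /tau; field; rewrite !gt_eqF.
  rewrite ler_wpM2l ?invr_ge0 ?(ltW tau_gt0) //; apply: le_trans count _.
  by rewrite ler_wpM2l // mulr_ge0 ?sqr_ge0.
have sqrt_ge0 : 0 <= Num.sqrt a * N%:R by rewrite mulr_ge0 ?sqrtr_ge0.
have le_Nl : N%:R <= l * N%:R by rewrite ler_peMl.
have C0l_ge0 : 0 <= C0 * (l * N%:R) by rewrite mulr_ge0 // (le_trans _ le_Nl).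
have Ca_ge0 : 0 <= C * (Num.sqrt a * N%:R) by rewrite mulr_ge0.
have CN_ge0 : 0 <= C * N%:R by rewrite mulr_ge0.
have CN_le : C * N%:R <= C * (l * N%:R) by rewrite ler_wpM2l.
move: smooth; rewrite ler_norml => /andP[smooth_ge smooth_le] /andP[sum_ge sum_le].
move: near_le near_ge near_ge0 count far smooth_ge smooth_le sum_ge sum_le.
rewrite -/C0.
clearbody C0 C; move: C0_ge0 C_ge0 sqrt_ge0 le_Nl C0l_ge0 Ca_ge0 CN_ge0 CN_le.
move: (tau^-1) C C0 (Num.sqrt a).
do 5! move: (bigop _ _ _); move: (N%:R) (ln N%:R); clear.
move=> n lnN U S F M near tau_inv C C0 u _ _ un_ge0 nl_ge C0l_ge0 Cu_ge0 Cn_ge0 Cn_le.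
move=> near_le near_ge near_ge0 count far smooth_ge smooth_le sum_ge sum_le.
by split=> [|/near_ge {}near_ge]; [rewrite ler_norml; apply/andP; split; lra | lra].
Qed.
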